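(* Let $X$ be an $n$-dimensional complex Banach space with an absolute norm and let $k\ge2$ be an integer. Then $n^{(k)}(X)=1$ if and only if $X$ is isometric to $\ell_\infty^n$.
   Context: A norm on $\mathbb{C}^n$ is absolute if $\|(a_1,\dots,a_n)\|=\|(|a_1|,\dots,|a_n|)\|$ for all scalars and $\|e_j\|=1$ for the canonical basis vectors. For $f:B_X\to X$ bounded, the numerical radius is $v(f)=\sup\{|x^*(f(x))|:x\in S_X,\ x^*\in S_{X^*},\ x^*(x)=1\}$. The $k$-polynomial numerical index is $n^{(k)}(X)=\inf\{v(P):P\in\mathcal{P}({}^kX:X),\ \|P\|=1\}$, where $\mathcal{P}({}^kX:X)$ is the space of $k$-homogeneous polynomials $X\to X$ with norm $\|P\|=\sup_{x\in B_X}\|P(x)\|$. *)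

(* Defs.v *)
From Stdlib Require Import Reals.
Open Scope R_scope.

Record C := mkC { Cre : R; Cim : R }.
Definition C0 : C := mkC 0 0.
Definition C1 : C := mkC 1 0.
Definition Cadd (z w : C) : C := mkC (Cre z + Cre w) (Cim z + Cim w).
Definition Cmul (z w : C) : C :=
  mkC (Cre z * Cre w - Cim z * Cim w) (Cre z * Cim w + Cim z * Cre w).
Definition Cmod (z : C) : R := sqrt (Cre z ^ 2 + Cim z ^ 2).

Definition fin (n : nat) := {i : nat | (i < n)%nat}.
Definition V (n : nat) := fin n -> C.
Definition vadd {n} (x y : V n) : V n := fun i => Cadd (x i) (y i).
Definition vscale {n} (a : C) (x : V n) : V n := fun i => Cmul a (x i).
Definition vzero {n} : V n := fun _ => C0.
Definition ecan {n} (j : fin n) : V n :=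
  fun i => if Nat.eq_dec (proj1_sig i) (proj1_sig j) then C1 else C0.
Definition vabs {n} (x : V n) : V n := fun i => mkC (Cmod (x i)) 0.

Definition is_norm {n} (N : V n -> R) : Prop :=
  (forall x, N x = 0 -> forall i, x i = C0) /\
  (forall a x, N (vscale a x) = Cmod a * N x) /\
  (forall x y, N (vadd x y) <= N x + N y).

Definition absolute_norm {n} (N : V n -> R) : Prop :=
  (forall x, N x = N (vabs x)) /\ (forall j : fin n, N (ecan j) = 1).

Definition Clinear {n} (f : V n -> C) : Prop :=
  (forall x y, f (vadd x y) = Cadd (f x) (f y)) /\
  (forall a x, f (vscale a x) = Cmul a (f x)).

Definition vlinear {n m} (T : V n -> V m) : Prop :=
  (forall x y, T (vadd x y) = vadd (T x) (T y)) /\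
  (forall a x, T (vscale a x) = vscale a (T x)).

Definition upd {n k} (xs : fin k -> V n) (j : fin k) (u : V n) : fin k -> V n :=
  fun m => if Nat.eq_dec (proj1_sig m) (proj1_sig j) then u else xs m.

Definition multilinear {n k} (A : (fin k -> V n) -> V n) : Prop :=
  forall (xs : fin k -> V n) (j : fin k) (a : C) (u v : V n),
    A (upd xs j (vadd (vscale a u) v)) =
    vadd (vscale a (A (upd xs j u))) (A (upd xs j v)).

(* k-homogeneous polynomials X -> X : P(x) = A(x,...,x), A k-linear
   (continuity is automatic in finite dimension) *)
Definition khom_poly {n} (k : nat) (P : V n -> V n) : Prop :=
  exists A : (fin k -> V n) -> V n, multilinear A /\ forall x, P x = A (fun _ => x).

Definition is_glb (E : R -> Prop) (m : R) : Prop :=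
  (forall x, E x -> m <= x) /\ (forall b, (forall x, E x -> b <= x) -> b <= m).

Definition polynorm_is {n} (N : V n -> R) (P : V n -> V n) (r : R) : Prop :=
  is_lub (fun s => exists x, N x <= 1 /\ s = N (P x)) r.

Definition dualnorm_is {n} (N : V n -> R) (f : V n -> C) (r : R) : Prop :=
  is_lub (fun s => exists y, N y <= 1 /\ s = Cmod (f y)) r.

Definition numrad_is {n} (N : V n -> R) (P : V n -> V n) (r : R) : Prop :=
  is_lub (fun s => exists (x : V n) (f : V n -> C),
             N x = 1 /\ Clinear f /\ dualnorm_is N f 1 /\ f x = C1 /\
             s = Cmod (f (P x))) r.

Definition poly_numindex_is {n} (N : V n -> R) (k : nat) (r : R) : Prop :=
  is_glb (fun s => exists P : V n -> V n,
             khom_poly k P /\ polynorm_is N P 1 /\ numrad_is N P s) r.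

Definition linf_is {n} (x : V n) (r : R) : Prop :=
  is_lub (fun t => exists i, t = Cmod (x i)) r.

Definition isometric_to_linf {n} (N : V n -> R) : Prop :=
  exists T : V n -> V n,
    vlinear T /\ (forall y, exists x, T x = y) /\ (forall x, linf_is (T x) (N x)).

(* Main.v *)
(** An absolute norm [N] with [N (e_j) = 1] is monotone in the moduli of the
    coordinates, so it is the sup norm as soon as [N (1, ..., 1) <= 1].
    Otherwise there are an interval [J] of coordinates with end points [p <> q]
    such that [D := N (1_J) > 1], while removing [p] or [q] from [J] makes the
    norm at most [1]. Put [y := (1_J - 2 e_q) / D], a unit vector, and
    [g x := (x_p + x_q)^(k-2) ((x_p + x_q)^2 + x_p x_q)]. The supremum of [|g|]
    on the ball is at least [5/4], whereas [|g|] is close to at most [1] when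
    [x_p] or [x_q] is close to [0]; so near the maximum [x_p] and [x_q] are
    nonzero and have almost the same phase. A functional [f] norming [x]
    satisfies [f(e_p) x_p >= 0] and [f(e_q) x_q >= 0], hence [f(e_p)] and
    [f(e_q)] almost cancel in modulus in [f y], which makes [|f y|] close to at
    most [1 / D]. Therefore [x |-> g x y] has numerical radius less than its
    norm.

    Conversely, on the polydisc a homogeneous polynomial is almost maximal at a
    point [w] of the torus, where every coordinate functional multiplied by the
    conjugate of [w_j] norms [w]. The maximum principle is applied one variable
    at a time: [|f|^2 + eps |.|^2] increases at one of the points [z + i^l t], so
    a point where it is nearly maximal on [|z| <= 1 - t] has a neighbour near
    the unit circle with a larger value. *)

From Stdlib Require Import Reals Lra Lia Arith.
From Stdlib Require Import FunctionalExtensionality Classical ClassicalEpsilon.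
Require Import Defs.
Open Scope R_scope.

(** * Complex numbers *)

Lemma Ceq (z w : C) : Cre z = Cre w -> Cim z = Cim w -> z = w.
Proof. destruct z, w; simpl; intros -> ->; reflexivity. Qed.

Definition Copp (z : C) : C := mkC (- Cre z) (- Cim z).
Definition Csub (z w : C) : C := Cadd z (Copp w).
Definition RtoC (r : R) : C := mkC r 0.
Definition Cconj (z : C) : C := mkC (Cre z) (- Cim z).
Fixpoint Cpow (z : C) (k : nat) : C :=
  match k with O => C1 | S k => Cmul z (Cpow z k) end.

Lemma C_ring_theory : ring_theory C0 C1 Cadd Cmul Csub Copp (@eq C).
Proof.
  constructor; intros; try reflexivity; apply Ceq; simpl; ring.
Qed.
Add Ring C_ring : C_ring_theory.

Ltac Cring := apply Ceq; simpl; ring.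

Lemma Cmod_ge0 (z : C) : 0 <= Cmod z.
Proof. apply sqrt_pos. Qed.

Lemma Cmod_sqr (z : C) : Cmod z ^ 2 = Cre z ^ 2 + Cim z ^ 2.
Proof. unfold Cmod. rewrite pow2_sqrt; nra. Qed.

Lemma Cmod_mul (z w : C) : Cmod (Cmul z w) = Cmod z * Cmod w.
Proof.
  unfold Cmod. rewrite <- sqrt_mult by nra. f_equal. simpl. ring.
Qed.

Lemma Cmod_RtoC (r : R) : Cmod (RtoC r) = Rabs r.
Proof.
  unfold Cmod, RtoC; simpl Cre; simpl Cim.
  replace (r ^ 2 + 0 ^ 2) with (Rsqr r) by (unfold Rsqr; ring).
  apply sqrt_Rsqr_abs.
Qed.

Lemma Cmod_C0 : Cmod C0 = 0.
Proof. change C0 with (RtoC 0). rewrite Cmod_RtoC. apply Rabs_R0. Qed.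

Lemma Cmod_C1 : Cmod C1 = 1.
Proof. change C1 with (RtoC 1). rewrite Cmod_RtoC. apply Rabs_R1. Qed.

Lemma Cmod_opp (z : C) : Cmod (Copp z) = Cmod z.
Proof. unfold Cmod; f_equal; simpl; ring. Qed.

Lemma Cmod_conj (z : C) : Cmod (Cconj z) = Cmod z.
Proof. unfold Cmod; f_equal; simpl; ring. Qed.

Lemma Cmod_pow (z : C) (k : nat) : Cmod (Cpow z k) = Cmod z ^ k.
Proof.
  induction k; simpl; [apply Cmod_C1 | rewrite Cmod_mul, IHk; reflexivity].
Qed.

Lemma Cmod_eq0 (z : C) : Cmod z = 0 -> z = C0.
Proof.
  intros H. pose proof (Cmod_sqr z) as E. rewrite H in E.
  apply Ceq; simpl; nra.
Qed.

Lemma Rle_of_sqr (a b : R) : 0 <= b -> a ^ 2 <= b ^ 2 -> a <= b.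
Proof. intros; nra. Qed.

Lemma Cauchy_Schwarz_C (z w : C) :
  Rabs (Cre z * Cre w + Cim z * Cim w) <= Cmod z * Cmod w.
Proof.
  pose proof (Cmod_ge0 z); pose proof (Cmod_ge0 w).
  apply Rle_of_sqr; [nra|].
  rewrite Rpow_mult_distr, !Cmod_sqr, pow2_abs.
  pose proof (pow2_ge_0 (Cre z * Cim w - Cim z * Cre w)). nra.
Qed.

Lemma Cmod_add_sqr (z w : C) :
  Cmod (Cadd z w) ^ 2
  = Cmod z ^ 2 + Cmod w ^ 2 + 2 * (Cre z * Cre w + Cim z * Cim w).
Proof. rewrite !Cmod_sqr; simpl; ring. Qed.

Lemma Cmod_add (z w : C) : Cmod (Cadd z w) <= Cmod z + Cmod w.
Proof.
  pose proof (Cmod_ge0 z); pose proof (Cmod_ge0 w).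
  apply Rle_of_sqr; [lra|]. rewrite Cmod_add_sqr.
  pose proof (Cauchy_Schwarz_C z w).
  pose proof (Rle_abs (Cre z * Cre w + Cim z * Cim w)). nra.
Qed.

Lemma Cmod_sub (z w : C) : Cmod z - Cmod w <= Cmod (Csub z w).
Proof.
  pose proof (Cmod_add (Csub z w) w).
  replace (Cadd (Csub z w) w) with z in H by ring. lra.
Qed.

Lemma Cmul_conj (z : C) : Cmul (Cconj z) z = RtoC (Cmod z ^ 2).
Proof. rewrite Cmod_sqr. Cring. Qed.

Lemma C_polar (z : C) : exists t, Cmod t = 1 /\ z = Cmul t (RtoC (Cmod z)).
Proof.
  destruct (Req_dec (Cmod z) 0) as [H|H].
  - exists C1. split; [apply Cmod_C1|]. rewrite H.
    rewrite (Cmod_eq0 z H). Cring.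
  - exists (Cmul (RtoC (/ Cmod z)) z). split.
    + rewrite Cmod_mul, Cmod_RtoC, Rabs_pos_eq; [field; auto|].
      pose proof (Cmod_ge0 z). left; apply Rinv_0_lt_compat; lra.
    + apply Ceq; simpl; field; auto.
Qed.

(** Rotating a coordinate preserves an absolute norm, so this equality turns a bound on [|f|] at
    rotated vectors into a bound on a sum of moduli. *)
Lemma C_align (a b : C) :
  exists t, Cmod t = 1 /\ Cmod (Cadd (Cmul t a) b) = Cmod a + Cmod b.
Proof.
  destruct (C_polar a) as [s [Hs Ea]], (C_polar b) as [r [Hr Eb]].
  exists (Cmul r (Cconj s)). split.
  { rewrite Cmod_mul, Cmod_conj, Hs, Hr; ring. }
  pose proof (Cmod_ge0 a); pose proof (Cmod_ge0 b).
  replace (Cadd (Cmul (Cmul r (Cconj s)) a) b)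
    with (Cmul r (RtoC (Cmod a + Cmod b))).
  { rewrite Cmod_mul, Hr, Cmod_RtoC, Rabs_pos_eq; lra. }
  rewrite Ea at 2. rewrite Eb at 2.
  replace (Cmul (Cmul r (Cconj s)) (Cmul s (RtoC (Cmod a))))
    with (Cmul r (Cmul (Cmul (Cconj s) s) (RtoC (Cmod a)))) by ring.
  rewrite Cmul_conj, Hs. Cring.
Qed.

(** Real parts are at most moduli, so [1 = Re a + Re b <= |a| + |b| <= 1] forces [Re a = |a|]. *)
Lemma C_nonneg_of_sum_1 (a b : C) :
  Cadd a b = C1 -> Cmod a + Cmod b <= 1 -> a = RtoC (Cmod a).
Proof.
  intros E H.
  assert (Hre : Cre a + Cre b = 1) by (change 1 with (Cre C1); rewrite <- E; reflexivity).
  pose proof (Cmod_ge0 a); pose proof (Cmod_ge0 b).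
  pose proof (Cmod_sqr a); pose proof (Cmod_sqr b).
  assert (Cre a <= Cmod a) by (apply Rle_of_sqr; nra).
  assert (Cre b <= Cmod b) by (apply Rle_of_sqr; nra).
  assert (Ea : Cre a = Cmod a) by lra.
  apply Ceq; simpl; [exact Ea|].
  assert (Cim a ^ 2 = 0) by (rewrite Ea in *; lra). nra.
Qed.

(** * Absolute norms *)

Lemma fin_eq {n} (i j : fin n) : proj1_sig i = proj1_sig j -> i = j.
Proof.
  destruct i as [i Hi], j as [j Hj]; simpl; intros ->.
  f_equal. apply le_unique.
Qed.

Definition vset {n} (x : V n) (j : fin n) (a : C) : V n :=
  fun i => if Nat.eq_dec (proj1_sig i) (proj1_sig j) then a else x i.

Ltac vcase :=
  repeat match goal with
  | |- context [Nat.eq_dec ?a ?b] => destruct (Nat.eq_dec a b)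
  end.

Lemma vset_self {n} (x : V n) j : vset x j (x j) = x.
Proof.
  extensionality i. unfold vset; vcase; [|reflexivity].
  apply fin_eq in e; subst; reflexivity.
Qed.

Lemma vset_split {n} (x : V n) j a :
  vset x j a = vadd (vscale a (ecan j)) (vset x j C0).
Proof.
  extensionality i. unfold vset, vadd, vscale, ecan. vcase; ring.
Qed.

Section AbsoluteNorm.
Context {n : nat} (N : V n -> R).
Hypothesis HN : is_norm N.
Hypothesis HA : absolute_norm N.

Lemma norm_scale a x : N (vscale a x) = Cmod a * N x.
Proof. apply HN. Qed.

Lemma norm_add x y : N (vadd x y) <= N x + N y.
Proof. apply HN. Qed.

Lemma norm_ecan j : N (ecan j) = 1.
Proof. apply HA. Qed.

Lemma norm_eq_mod x y : (forall i, Cmod (x i) = Cmod (y i)) -> N x = N y.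
Proof.
  intros H. destruct HA as [Ha _]. rewrite (Ha x), (Ha y). f_equal.
  extensionality i. unfold vabs. rewrite H. reflexivity.
Qed.

Lemma norm_ge0 x : 0 <= N x.
Proof.
  assert (N (vscale C0 x) = 0) by (rewrite norm_scale, Cmod_C0; ring).
  pose proof (norm_add x (vscale (Copp C1) x)) as H1.
  rewrite norm_scale, Cmod_opp, Cmod_C1 in H1.
  replace (vadd x (vscale (Copp C1) x)) with (vscale C0 x) in H1; [lra|].
  extensionality i. unfold vadd, vscale. ring.
Qed.

(* Shrinking a coordinate by a factor [t] averages the vector with its
   reflection in that coordinate, which has the same norm. *)
Lemma norm_vset_le x j a b : Cmod a <= Cmod b -> N (vset x j a) <= N (vset x j b).
Proof.
  intros H. pose proof (Cmod_ge0 a) as Ha.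
  destruct (Req_dec (Cmod b) 0) as [Hb|Hb].
  { right. f_equal. f_equal. rewrite (Cmod_eq0 b Hb). apply Cmod_eq0; lra. }
  set (t := Cmod a / Cmod b).
  assert (Hb' : 0 < Cmod b) by lra.
  assert (Ht : 0 <= t <= 1).
  { unfold t; split; [apply Rmult_le_pos; [lra|left; apply Rinv_0_lt_compat; lra]|].
    apply Rmult_le_reg_r with (Cmod b); [lra|].
    unfold Rdiv; rewrite Rmult_assoc, Rinv_l; lra. }
  rewrite (norm_eq_mod (vset x j a) (vset x j (Cmul (RtoC t) b))).
  2:{ intros i. unfold vset; vcase; [|reflexivity].
      rewrite Cmod_mul, Cmod_RtoC, Rabs_pos_eq by lra. unfold t; field; lra. }
  replace (vset x j (Cmul (RtoC t) b))
    with (vadd (vscale (RtoC ((1 + t) / 2)) (vset x j b))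
               (vscale (RtoC ((1 - t) / 2)) (vset x j (Copp b)))).
  2:{ extensionality i. unfold vadd, vscale, vset; vcase; apply Ceq; simpl; field. }
  eapply Rle_trans; [apply norm_add|].
  rewrite !norm_scale, !Cmod_RtoC, !Rabs_pos_eq by lra.
  rewrite (norm_eq_mod (vset x j (Copp b)) (vset x j b)).
  2:{ intros i; unfold vset; vcase; [apply Cmod_opp|reflexivity]. }
  lra.
Qed.

Lemma norm_mono x y : (forall i, Cmod (x i) <= Cmod (y i)) -> N x <= N y.
Proof.
  intros H.
  (* Consecutive vectors [mix d] and [mix (S d)] differ in one coordinate only, so [norm_vset_le]
     applies to each step from [y] to [x]. *)
  set (mix := fun d : nat => (fun i => if lt_dec (proj1_sig i) d then x i else y i) : V n).
  assert (Hd : forall d, (d <= n)%nat -> N (mix d) <= N y).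
  { induction d as [|d IH]; intros Hd.
    - right; reflexivity.
    - set (j := exist (fun i => (i < n)%nat) d Hd : fin n).
      eapply Rle_trans; [|apply IH; lia].
      replace (mix (S d)) with (vset (mix d) j (x j)).
      2:{ extensionality i. unfold vset, mix. vcase.
          - apply fin_eq in e; subst i; simpl. destruct lt_dec; [reflexivity|lia].
          - simpl in *. destruct (lt_dec _ d), (lt_dec _ (S d)); try reflexivity; lia. }
      replace (mix d) with (vset (mix d) j (y j)) at 2.
      2:{ replace (y j) with (mix d j); [apply vset_self|].
          unfold mix; simpl. destruct lt_dec; [lia|reflexivity]. }
      apply norm_vset_le, H. }
  replace x with (mix n); [apply Hd; lia|].
  extensionality i. unfold mix. destruct lt_dec; [reflexivity|].
  destruct i; simpl in *; lia.
Qed.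

Lemma coord_le_norm x j : Cmod (x j) <= N x.
Proof.
  rewrite <- (Rmult_1_r (Cmod (x j))), <- (norm_ecan j), <- norm_scale.
  apply norm_mono. intros i. unfold vscale, ecan. vcase.
  - apply fin_eq in e; subst. right; f_equal; ring.
  - rewrite Cmod_mul, Cmod_C0, Rmult_0_r. apply Cmod_ge0.
Qed.

Lemma dual_le f x : Clinear f -> dualnorm_is N f 1 -> Cmod (f x) <= N x.
Proof.
  intros [_ Hs] [Hub _].
  destruct (Req_dec (N x) 0) as [H|H].
  { assert (E : x = vscale C0 x).
    { extensionality i. destruct HN as [H0 _]. rewrite (H0 x H i).
      unfold vscale. ring. }
    rewrite E, Hs, Cmod_mul, Cmod_C0, Rmult_0_l. apply norm_ge0. }
  pose proof (norm_ge0 x) as Hx.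
  assert (Hi : 0 <= / N x) by (left; apply Rinv_0_lt_compat; lra).
  assert (Hb : Cmod (f (vscale (RtoC (/ N x)) x)) <= 1).
  { apply Hub. exists (vscale (RtoC (/ N x)) x). split; [|reflexivity].
    rewrite norm_scale, Cmod_RtoC, Rabs_pos_eq by assumption.
    right; field; assumption. }
  rewrite Hs, Cmod_mul, Cmod_RtoC, Rabs_pos_eq in Hb by assumption.
  apply Rmult_le_reg_l with (/ N x); [apply Rinv_0_lt_compat; lra|].
  rewrite Rinv_l; assumption.
Qed.

Lemma coord_dual j :
  Clinear (fun x : V n => x j) /\ dualnorm_is N (fun x => x j) 1.
Proof.
  split; [split; reflexivity|split].
  - intros s [y [Hy ->]]. eapply Rle_trans; [apply coord_le_norm|exact Hy].
  - intros b Hb. apply Hb. exists (ecan j). rewrite norm_ecan. split; [lra|].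
    unfold ecan; vcase; [rewrite Cmod_C1; reflexivity|congruence].
Qed.

(* Rotating one coordinate of [x] does not change its norm, so the part of
   [f x = 1] carried by that coordinate must be nonnegative. *)
Lemma dual_coord_nonneg f x j :
  Clinear f -> dualnorm_is N f 1 -> N x = 1 -> f x = C1 ->
  Cmul (f (ecan j)) (x j) = RtoC (Cmod (f (ecan j)) * Cmod (x j)).
Proof.
  intros Hf Hd Hx H1. destruct Hf as [Hadd Hsc] eqn:Ef; clear Ef.
  assert (E : forall a, f (vset x j a) = Cadd (Cmul a (f (ecan j))) (f (vset x j C0))).
  { intros a. rewrite vset_split, Hadd, Hsc. reflexivity. }
  destruct (C_align (Cmul (x j) (f (ecan j))) (f (vset x j C0))) as [t [Ht Ha]].
  rewrite <- Cmod_mul.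
  replace (Cmul (f (ecan j)) (x j)) with (Cmul (x j) (f (ecan j))) by ring.
  apply C_nonneg_of_sum_1 with (f (vset x j C0)).
  - rewrite <- E, vset_self. exact H1.
  - rewrite <- Ha.
    replace (Cmul t (Cmul (x j) (f (ecan j)))) with (Cmul (Cmul t (x j)) (f (ecan j))) by ring.
    rewrite <- E. eapply Rle_trans; [apply dual_le; assumption|].
    rewrite <- Hx. right. apply norm_eq_mod. intros i. unfold vset; vcase; [|reflexivity].
    apply fin_eq in e; subst. rewrite Cmod_mul, Ht. ring.
Qed.

(** A unit scalar on [e_j] aligns [f e_j] with [f w]; since [w] vanishes at [j], the moduli of the
    coordinates of [w + e_j] do not change. *)
Lemma dual_block_le f w j :
  Clinear f -> dualnorm_is N f 1 -> w j = C0 ->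
  Cmod (f w) + Cmod (f (ecan j)) <= N (vadd w (ecan j)).
Proof.
  intros Hf Hd Hw. destruct (C_align (f (ecan j)) (f w)) as [t [Ht Ha]].
  rewrite Rplus_comm, <- Ha.
  rewrite <- (proj2 Hf), <- (proj1 Hf).
  eapply Rle_trans; [apply dual_le; assumption|].
  right. apply norm_eq_mod. intros i. unfold vadd, vscale, ecan. vcase.
  - apply fin_eq in e; subst. rewrite Hw.
    replace (Cadd (Cmul t C1) C0) with t by ring.
    replace (Cadd C0 C1) with C1 by ring. rewrite Cmod_C1; exact Ht.
  - f_equal; ring.
Qed.

End AbsoluteNorm.

(** * Homogeneous polynomials *)

(** Scalar counterparts of [multilinear] and [khom_poly], for the factor [g] in [g x * y] and for
    single coordinates of a polynomial map. *)
Definition mlinC {n k} (A : (fin k -> V n) -> C) : Prop :=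
  forall (xs : fin k -> V n) (j : fin k) (a : C) (u v : V n),
    A (upd xs j (vadd (vscale a u) v)) =
    Cadd (Cmul a (A (upd xs j u))) (A (upd xs j v)).

Definition khomC {n} (k : nat) (g : V n -> C) : Prop :=
  exists A : (fin k -> V n) -> C, mlinC A /\ forall x, g x = A (fun _ => x).

Definition fzero {k} : fin (S k) := exist _ O (Nat.lt_0_succ k).
Definition fsucc {k} (m : fin k) : fin (S k) :=
  exist _ (S (proj1_sig m)) (proj1 (Nat.succ_lt_mono _ _) (proj2_sig m)).

Lemma khomC_const {n} (c : C) : khomC 0 (fun _ : V n => c).
Proof.
  exists (fun _ => c). split; [|reflexivity].
  intros xs [j Hj]; exfalso; lia.
Qed.

(** [L] takes argument [0] and [A] the remaining ones, so varying one argument affects only one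
    factor. *)
Lemma khomC_mul {n} k (L g : V n -> C) :
  Clinear L -> khomC k g -> khomC (S k) (fun x => Cmul (L x) (g x)).
Proof.
  intros [La Ls] [A [HA Hg]].
  exists (fun xs => Cmul (L (xs fzero)) (A (fun m => xs (fsucc m)))).
  split; [|intros x; rewrite Hg; reflexivity].
  intros xs [[|j] Hj] a u v.
  - change (upd xs (exist _ 0%nat Hj) (vadd (vscale a u) v) fzero) with (vadd (vscale a u) v).
    change (upd xs (exist _ 0%nat Hj) u fzero) with u.
    change (upd xs (exist _ 0%nat Hj) v fzero) with v.
    change (fun m => upd xs (exist _ 0%nat Hj) (vadd (vscale a u) v) (fsucc m))
      with (fun m => xs (@fsucc k m)).
    change (fun m => upd xs (exist _ 0%nat Hj) u (fsucc m)) with (fun m => xs (@fsucc k m)).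
    change (fun m => upd xs (exist _ 0%nat Hj) v (fsucc m)) with (fun m => xs (@fsucc k m)).
    rewrite La, Ls. ring.
  - set (j' := exist (fun i => (i < k)%nat) j (proj2 (Nat.succ_lt_mono _ _) Hj) : fin k).
    assert (E : forall t, (fun m => upd xs (exist _ (S j) Hj) t (fsucc m))
                          = upd (fun m => xs (fsucc m)) j' t).
    { intros t. extensionality m. unfold upd; simpl proj1_sig.
      vcase; try reflexivity; lia. }
    rewrite !E. change (upd xs (exist _ (S j) Hj) (vadd (vscale a u) v) fzero) with (xs fzero).
    change (upd xs (exist _ (S j) Hj) u fzero) with (xs fzero).
    change (upd xs (exist _ (S j) Hj) v fzero) with (xs fzero).
    rewrite HA. ring.
Qed.

Lemma khomC_add {n} k (g h : V n -> C) :
  khomC k g -> khomC k h -> khomC k (fun x => Cadd (g x) (h x)).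
Proof.
  intros [A [HA Hg]] [B [HB Hh]]. exists (fun xs => Cadd (A xs) (B xs)).
  split; [|intros x; rewrite Hg, Hh; reflexivity].
  intros xs j a u v. rewrite HA, HB. ring.
Qed.

Lemma khomC_pow {n} k (L : V n -> C) : Clinear L -> khomC k (fun x => Cpow (L x) k).
Proof.
  intros HL. induction k as [|k IH]; [exact (khomC_const C1)|].
  apply (khomC_mul k L (fun x => Cpow (L x) k)); assumption.
Qed.

Lemma khomC_vec {n} k (g : V n -> C) (y : V n) :
  khomC k g -> khom_poly k (fun x => vscale (g x) y).
Proof.
  intros [A [HA Hg]]. exists (fun xs => vscale (A xs) y).
  split; [|intros x; rewrite Hg; reflexivity].
  intros xs j a u v. rewrite HA. extensionality i. unfold vscale, vadd. ring.
Qed.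

(** * The two-coordinate peaking polynomial *)

(* Homogeneous of degree [k + 2]. *)
Definition gpol (k : nat) (z w : C) : C :=
  Cmul (Cpow (Cadd z w) k)
       (Cadd (Cmul (Cadd z w) (Cadd z w)) (Cmul z w)).

Lemma Cmod_gpol_le k z w :
  Cmod (gpol k z w)
  <= Cmod (Cadd z w) ^ k * (Cmod (Cadd z w) ^ 2 + Cmod z * Cmod w).
Proof.
  unfold gpol. rewrite Cmod_mul, Cmod_pow.
  apply Rmult_le_compat_l; [apply pow_le, Cmod_ge0|].
  eapply Rle_trans; [apply Cmod_add|]. rewrite !Cmod_mul. lra.
Qed.

(** Nothing cancels at nonnegative reals; this makes the upper bound in terms of moduli a value of
    [|g|], taken at [vabs x]. *)
Lemma gpol_RtoC k r s : 0 <= r -> 0 <= s ->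
  Cmod (gpol k (RtoC r) (RtoC s)) = (r + s) ^ k * ((r + s) ^ 2 + r * s).
Proof.
  intros Hr Hs. unfold gpol. rewrite Cmod_mul, Cmod_pow.
  replace (Cadd (RtoC r) (RtoC s)) with (RtoC (r + s)) by Cring.
  replace (Cadd (Cmul (RtoC (r + s)) (RtoC (r + s))) (Cmul (RtoC r) (RtoC s)))
    with (RtoC ((r + s) ^ 2 + r * s)) by Cring.
  rewrite !Cmod_RtoC, !Rabs_pos_eq; nra.
Qed.

Lemma gpol_khom {n} k (p q : fin n) :
  khomC (S (S k)) (fun x : V n => gpol k (x p) (x q)).
Proof.
  assert (Lp : Clinear (fun x : V n => x p)) by (split; reflexivity).
  assert (Lq : Clinear (fun x : V n => x q)) by (split; reflexivity).
  assert (Ls : Clinear (fun x : V n => Cadd (x p) (x q))).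
  { split; intros; unfold vadd, vscale; ring. }
  pose proof (khomC_pow k _ Ls) as H0.
  pose proof (khomC_add _ _ _
    (khomC_mul _ _ _ Ls (khomC_mul _ _ _ Ls H0))
    (khomC_mul _ _ _ Lp (khomC_mul _ _ _ Lq H0))) as H.
  replace (fun x : V n => gpol k (x p) (x q)) with
    (fun x : V n => Cadd
      (Cmul (Cadd (x p) (x q)) (Cmul (Cadd (x p) (x q)) (Cpow (Cadd (x p) (x q)) k)))
      (Cmul (x p) (Cmul (x q) (Cpow (Cadd (x p) (x q)) k)))); [exact H|].
  extensionality x. unfold gpol. ring.
Qed.

(** The right side is the chord over [[0, 1]] of a convex function of [s]. *)
Lemma pow_1_plus_le k s : 0 <= s <= 1 -> (1 + s) ^ k <= 1 + (2 ^ k - 1) * s.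
Proof.
  intros Hs. induction k as [|k IH]; simpl; [lra|].
  assert (1 <= 2 ^ k) by (apply pow_R1_Rle; lra).
  apply Rle_trans with ((1 + s) * (1 + (2 ^ k - 1) * s)).
  - apply Rmult_le_compat_l; lra.
  - assert (0 <= (2 ^ k - 1) * (s * (1 - s))) by (apply Rmult_le_pos; nra). nra.
Qed.

(** If [s] is the small modulus, the expression is at most [(1 + s)^(k+3) <= 1 + B s] with
    [B = 2^(k+3)], and [s0 = 1 / (8 B)] keeps the excess within [1/8]. The result stays [1/8] below
    the value [5/4] that [|g|] takes on the ball. *)
Lemma gpol_small_near_axis k :
  exists s0, 0 < s0 <= 1 /\ forall r s, 0 <= r <= 1 -> 0 <= s <= 1 ->
    r <= s0 \/ s <= s0 -> (r + s) ^ k * ((r + s) ^ 2 + r * s) <= 9 / 8.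
Proof.
  set (B := 2 ^ (k + 3)).
  assert (HB : 1 <= B) by (apply pow_R1_Rle; lra).
  exists (/ (8 * B)).
  assert (H0 : 0 < / (8 * B)) by (apply Rinv_0_lt_compat; lra).
  assert (H1 : 8 * B * / (8 * B) = 1) by (apply Rinv_r; lra).
  split; [nra|].
  assert (K : forall r s, 0 <= r <= 1 -> 0 <= s <= 1 -> s <= / (8 * B) ->
            (r + s) ^ k * ((r + s) ^ 2 + r * s) <= 9 / 8).
  { intros r s Hr Hs Hsm.
    apply Rle_trans with ((1 + s) ^ (k + 3)).
    - rewrite pow_add. apply Rmult_le_compat.
      + apply pow_le; lra.
      + nra.
      + apply pow_incr; lra.
      + assert (r * s <= s) by nra.
        assert ((r + s) ^ 2 <= (1 + s) ^ 2) by (apply pow_incr; lra).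
        assert (0 <= s ^ 3) by (apply pow_le; lra). nra.
    - eapply Rle_trans; [apply pow_1_plus_le; assumption|]. fold B. nra. }
  intros r s Hr Hs [H|H]; [|apply K; assumption].
  replace (r + s) with (s + r) by ring. replace (r * s) with (s * r) by ring.
  apply K; assumption.
Qed.

(* The last hypothesis says that the phases of [z] and [w] almost agree; those
   of [u] and [v] are their conjugates. *)
Lemma Cmod_sub_aligned z w u v eta :
  0 < Cmod z -> 0 < Cmod w -> 0 <= eta -> Cmod u <= 1 -> Cmod v <= 1 ->
  Cmul u z = RtoC (Cmod u * Cmod z) -> Cmul v w = RtoC (Cmod v * Cmod w) ->
  (Cmod z + Cmod w) ^ 2 - Cmod (Cadd z w) ^ 2 <= eta ^ 2 * (Cmod z * Cmod w) ->
  Cmod (Csub u v) <= Rabs (Cmod u - Cmod v) + eta.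
Proof.
  intros Hz Hw He Hu Hv Euz Evw H.
  pose proof (Cmod_ge0 u) as Hu0; pose proof (Cmod_ge0 v) as Hv0.
  rewrite Cmod_add_sqr in H.
  set (r := Cmod z) in *; set (s := Cmod w) in *.
  set (a := Cmod u) in *; set (b := Cmod v) in *.
  (* This is [u z = a r] multiplied by the conjugate of [z] and divided by [r]. *)
  assert (Eu : Cmul (RtoC r) u = Cmul (RtoC a) (Cconj z)).
  { assert (Hm : Cmul (RtoC (r ^ 2)) u = Cmul (RtoC (a * r)) (Cconj z)).
    { rewrite <- Euz. unfold r. rewrite <- Cmul_conj. ring. }
    apply (f_equal (Cmul (RtoC (/ r)))) in Hm.
    transitivity (Cmul (RtoC (/ r)) (Cmul (RtoC (r ^ 2)) u));
      [apply Ceq; simpl; field; lra|].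
    rewrite Hm. apply Ceq; simpl; field; lra. }
  assert (Ev : Cmul (RtoC s) v = Cmul (RtoC b) (Cconj w)).
  { assert (Hm : Cmul (RtoC (s ^ 2)) v = Cmul (RtoC (b * s)) (Cconj w)).
    { rewrite <- Evw. unfold s. rewrite <- Cmul_conj. ring. }
    apply (f_equal (Cmul (RtoC (/ s)))) in Hm.
    transitivity (Cmul (RtoC (/ s)) (Cmul (RtoC (s ^ 2)) v));
      [apply Ceq; simpl; field; lra|].
    rewrite Hm. apply Ceq; simpl; field; lra. }
  (* The angle between [u] and [v] equals that between [z] and [w], which the hypothesis on
     [|z + w|] controls. *)
  assert (Hip : r * s * (Cre u * Cre v + Cim u * Cim v)
                = a * b * (Cre z * Cre w + Cim z * Cim w)).
  { pose proof (f_equal Cre Eu) as E1; pose proof (f_equal Cim Eu) as E2.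
    pose proof (f_equal Cre Ev) as E3; pose proof (f_equal Cim Ev) as E4.
    simpl in E1, E2, E3, E4.
    replace (r * s * (Cre u * Cre v + Cim u * Cim v)) with
      ((r * Cre u - 0 * Cim u) * (s * Cre v - 0 * Cim v)
       + (r * Cim u + 0 * Cre u) * (s * Cim v + 0 * Cre v)) by ring.
    rewrite E1, E2, E3, E4. ring. }
  apply Rle_of_sqr; [pose proof (Rabs_pos (a - b)); lra|].
  unfold Csub. rewrite Cmod_add_sqr, Cmod_opp. fold a b.
  assert (Hsq : Rabs (a - b) ^ 2 = (a - b) ^ 2) by apply pow2_abs.
  assert (Hre : 2 * (a * b) - 2 * (Cre u * Cre v + Cim u * Cim v) <= eta ^ 2).
  { assert (Hrs : 0 < r * s) by nra.
    apply Rmult_le_reg_l with (r * s); [assumption|].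
    replace (r * s * (2 * (a * b) - 2 * (Cre u * Cre v + Cim u * Cim v)))
      with (a * b * (2 * (r * s - (Cre z * Cre w + Cim z * Cim w)))) by nra.
    assert (0 <= a * b <= 1) by nra.
    assert (0 <= eta ^ 2 * (r * s)) by (apply Rmult_le_pos; nra).
    apply Rle_trans with (a * b * (eta ^ 2 * (r * s))); [|nra].
    apply Rmult_le_compat_l; nra. }
  pose proof (Rabs_pos (a - b)). simpl.
  replace ((Rabs (a - b) + eta) * ((Rabs (a - b) + eta) * 1))
    with (Rabs (a - b) ^ 2 + 2 * (Rabs (a - b) * eta) + eta ^ 2) by ring.
  rewrite Hsq. assert (0 <= Rabs (a - b) * eta) by nra. nra.
Qed.

(** * Absolute norms with index one *)

Section NotSupNorm.
Context {n : nat} (N : V n -> R).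
Hypothesis HN : is_norm N.
Hypothesis HA : absolute_norm N.
(** In the application [w] is the indicator of the coordinates strictly between [p] and [q]. *)
Variables (p q : fin n) (w : V n).
Hypothesis Hpq : p <> q.
Hypothesis Hwp : w p = C0.
Hypothesis Hwq : w q = C0.
Hypothesis Hp : N (vadd w (ecan p)) <= 1.
Hypothesis Hq : N (vadd w (ecan q)) <= 1.

Let D := N (vadd w (vadd (ecan p) (ecan q))).
Hypothesis HD : 1 < D.

Let y : V n :=
  vscale (RtoC (/ D)) (vadd w (vadd (ecan p) (vscale (Copp C1) (ecan q)))).

Lemma flipped_norm : N y = 1.
Proof.
  unfold y. rewrite (norm_scale N HN), Cmod_RtoC.
  rewrite Rabs_pos_eq by (left; apply Rinv_0_lt_compat; lra).
  rewrite (norm_eq_mod N HA _ (vadd w (vadd (ecan p) (ecan q)))).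
  { fold D. field; lra. }
  intros i. unfold vadd, vscale, ecan. vcase.
  - exfalso. apply Hpq. rewrite <- (fin_eq i p), <- (fin_eq i q); auto.
  - f_equal; ring.
  - apply fin_eq in e; subst. rewrite Hwq.
    replace (Cadd C0 (Cadd C0 (Cmul (Copp C1) C1))) with (Copp C1) by ring.
    rewrite Cmod_opp. f_equal; ring.
  - f_equal; ring.
Qed.

(** If [|f e_p|] is the larger modulus, then [|f w| + |f e_p - f e_q| <= |f w| + |f e_p| + eta <= 1
    + eta] by [dual_block_le] at [p]; otherwise use [q]. *)
Lemma flipped_dual_le f eta :
  Clinear f -> dualnorm_is N f 1 ->
  Cmod (Csub (f (ecan p)) (f (ecan q)))
    <= Rabs (Cmod (f (ecan p)) - Cmod (f (ecan q))) + eta ->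
  Cmod (f y) <= (1 + eta) / D.
Proof.
  intros Hf Hd H.
  pose proof (dual_block_le N HN HA f w p Hf Hd Hwp) as Bp.
  pose proof (dual_block_le N HN HA f w q Hf Hd Hwq) as Bq.
  destruct Hf as [Hadd Hsc].
  unfold y. rewrite Hsc, !Hadd, Hsc, Cmod_mul, Cmod_RtoC.
  assert (HiD : 0 < / D) by (apply Rinv_0_lt_compat; lra).
  rewrite Rabs_pos_eq by lra. unfold Rdiv. rewrite Rmult_comm.
  apply Rmult_le_compat_r; [lra|].
  replace (Cadd (f (ecan p)) (Cmul (Copp C1) (f (ecan q))))
    with (Csub (f (ecan p)) (f (ecan q))) by ring.
  eapply Rle_trans; [apply Cmod_add|].
  pose proof (Cmod_ge0 (f (ecan p))); pose proof (Cmod_ge0 (f (ecan q))).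
  revert H. unfold Rabs. destruct Rcase_abs; intros; lra.
Qed.

Let g (k : nat) (x : V n) : C := gpol k (x p) (x q).

Lemma g_sup k : exists M, 5 / 4 <= M /\
  is_lub (fun s => exists x, N x <= 1 /\ s = Cmod (g k x)) M.
Proof.
  destruct (completeness (fun s => exists x, N x <= 1 /\ s = Cmod (g k x))) as [M HM].
  - exists (2 ^ k * (2 ^ 2 + 1 * 1)). intros s [x [Hx ->]].
    pose proof (coord_le_norm N HN HA x p) as H1.
    pose proof (coord_le_norm N HN HA x q) as H2.
    pose proof (Cmod_ge0 (x p)); pose proof (Cmod_ge0 (x q)).
    pose proof (Cmod_add (x p) (x q)) as H3.
    pose proof (Cmod_ge0 (Cadd (x p) (x q))).
    eapply Rle_trans; [apply Cmod_gpol_le|].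
    apply Rmult_le_compat; [apply pow_le; lra| |apply pow_incr; lra|].
    { apply Rplus_le_le_0_compat; [apply pow_le|apply Rmult_le_pos]; lra. }
    apply Rplus_le_compat; [apply pow_incr; lra|apply Rmult_le_compat; lra].
  - exists (Cmod (g k (ecan p))). exists (ecan p). split; [|reflexivity].
    rewrite (norm_ecan N HA). lra.
  - exists M. split; [|exact HM].
    (* Both coordinates are [1/2], so [|g| = 1 + 1/4] here. *)
    set (x := vscale (RtoC (1 / 2)) (vadd (ecan p) (ecan q))).
    apply Rle_trans with (Cmod (g k x)).
    + assert (Ep : x p = RtoC (1 / 2)).
      { unfold x, vscale, vadd, ecan. vcase; try congruence.
        - exfalso; apply Hpq, fin_eq; assumption.
        - ring. }
      assert (Eq : x q = RtoC (1 / 2)).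
      { unfold x, vscale, vadd, ecan. vcase; try congruence.
        - exfalso; apply Hpq, fin_eq; congruence.
        - ring. }
      unfold g. rewrite Ep, Eq, gpol_RtoC by lra.
      replace (1 / 2 + 1 / 2) with 1 by field. rewrite pow1. lra.
    + apply HM. exists x. split; [|reflexivity].
      unfold x. rewrite (norm_scale N HN), Cmod_RtoC, Rabs_pos_eq by lra.
      pose proof (norm_add N HN (ecan p) (ecan q)) as H.
      rewrite !(norm_ecan N HA) in H. lra.
Qed.

(** There are three regimes. If [|x_p|] or [|x_q|] is at most [s0], then [|g| <= 9/8]. If the phases
    nearly agree, [|f y|] is small and the loss is [d2]. Otherwise the defect in the triangle
    inequality for [x_p + x_q] costs [|g|] at least [d1]. *)
Lemma numrad_gap k M :
  5 / 4 <= M -> is_lub (fun s => exists x, N x <= 1 /\ s = Cmod (g k x)) M ->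
  exists d, 0 < d /\ forall x f, N x = 1 -> Clinear f -> dualnorm_is N f 1 ->
    f x = C1 -> Cmod (g k x) * Cmod (f y) <= M - d.
Proof.
  intros HM Hlub.
  destruct (gpol_small_near_axis k) as [s0 [Hs0 Hax]].
  (* With this choice [1 + eta <= (1 + D) / 2 < D], so [d2] is positive. *)
  set (eta := Rmin 1 ((D - 1) / 2)).
  assert (Heta : 0 < eta <= 1 /\ eta <= (D - 1) / 2).
  { unfold eta. pose proof (Rmin_l 1 ((D - 1) / 2)); pose proof (Rmin_r 1 ((D - 1) / 2)).
    repeat split; try lra. apply Rmin_glb_lt; lra. }
  assert (HiD : 0 < / D) by (apply Rinv_0_lt_compat; lra).
  assert (HDD : D * / D = 1) by (apply Rinv_r; lra).
  set (d1 := eta ^ 2 * (s0 * s0 * s0 ^ k)).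
  set (d2 := M * (1 - (1 + eta) / D)).
  assert (Hsk : 0 < s0 ^ k) by (apply pow_lt; lra).
  assert (Hd1 : 0 < d1).
  { unfold d1. apply Rmult_lt_0_compat; [nra|]. apply Rmult_lt_0_compat; nra. }
  assert (Hd2 : 0 < d2).
  { unfold d2, Rdiv. apply Rmult_lt_0_compat; [lra|]. nra. }
  exists (Rmin (1 / 8) (Rmin d1 d2)).
  pose proof (Rmin_l (1 / 8) (Rmin d1 d2)); pose proof (Rmin_r (1 / 8) (Rmin d1 d2)).
  pose proof (Rmin_l d1 d2); pose proof (Rmin_r d1 d2).
  split; [repeat apply Rmin_glb_lt; lra|].
  intros x f Hx Hf Hd Hfx.
  pose proof (coord_le_norm N HN HA x p) as Hr1.
  pose proof (coord_le_norm N HN HA x q) as Hs1.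
  pose proof (Cmod_ge0 (x p)) as Hr0; pose proof (Cmod_ge0 (x q)) as Hs0'.
  rewrite Hx in Hr1, Hs1.
  pose proof (Cmod_gpol_le k (x p) (x q)) as Hg. fold (g k x) in Hg.
  pose proof (Cmod_add (x p) (x q)) as Htri.
  pose proof (Cmod_ge0 (Cadd (x p) (x q))) as HA0.
  pose proof (Cmod_ge0 (g k x)) as Hg0.
  assert (Hfy : 0 <= Cmod (f y) <= 1).
  { split; [apply Cmod_ge0|]. rewrite <- flipped_norm. apply dual_le; assumption. }
  set (r := Cmod (x p)) in *. set (s := Cmod (x q)) in *.
  set (A := Cmod (Cadd (x p) (x q))) in *.
  assert (Hpw : 0 <= A ^ k <= (r + s) ^ k).
  { split; [apply pow_le; lra|apply pow_incr; lra]. }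
  assert (Hpow2 : 0 <= A ^ 2 <= (r + s) ^ 2).
  { split; [apply pow_le; lra|apply pow_incr; lra]. }
  (* [vabs x] has the norm of [x], so its value of [|g|] is also at most [M]. *)
  assert (HGM : (r + s) ^ k * ((r + s) ^ 2 + r * s) <= M).
  { rewrite <- gpol_RtoC by assumption. apply Hlub. exists (vabs x). split.
    - rewrite <- (proj1 HA). lra.
    - reflexivity. }
  assert (HgG : Cmod (g k x) <= (r + s) ^ k * ((r + s) ^ 2 + r * s)).
  { eapply Rle_trans; [exact Hg|]. apply Rmult_le_compat; nra. }
  destruct (Rle_dec r s0) as [Hrs|Hrs].
  { assert (Cmod (g k x) <= 9 / 8) by (eapply Rle_trans; [exact HgG|apply Hax; auto with real]). nra. }
  destruct (Rle_dec s s0) as [Hss|Hss].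
  { assert (Cmod (g k x) <= 9 / 8) by (eapply Rle_trans; [exact HgG|apply Hax; auto with real]). nra. }
  destruct (Rle_dec ((r + s) ^ 2 - A ^ 2) (eta ^ 2 * (r * s))) as [He|He].
  - assert (Hfe : forall j, Cmod (f (ecan j)) <= 1).
    { intros j. rewrite <- (norm_ecan N HA j). apply dual_le; assumption. }
    assert (Hb : Cmod (f y) <= (1 + eta) / D).
    { apply flipped_dual_le; try assumption.
      apply (Cmod_sub_aligned (x p) (x q)); try apply Hfe; try (fold r); try (fold s); try lra.
      - apply dual_coord_nonneg with N; assumption.
      - apply dual_coord_nonneg with N; assumption.
      - exact He. }
    apply Rle_trans with (M * ((1 + eta) / D)).
    + apply Rmult_le_compat; lra.
    + unfold d2 in *. lra.
  - assert (Hg2 : Cmod (g k x) <= (r + s) ^ k * ((r + s) ^ 2 + r * s - eta ^ 2 * (r * s))).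
    { eapply Rle_trans; [exact Hg|].
      apply Rmult_le_compat; [lra| |lra|lra].
      assert (0 <= r * s) by nra. lra. }
    assert (Hlow : d1 <= (r + s) ^ k * (eta ^ 2 * (r * s))).
    { unfold d1. replace (eta ^ 2 * (s0 * s0 * s0 ^ k)) with (s0 ^ k * (eta ^ 2 * (s0 * s0))) by ring.
      assert (0 <= eta ^ 2) by nra.
      apply Rmult_le_compat; [lra| |apply pow_incr; lra|].
      - apply Rmult_le_pos; nra.
      - apply Rmult_le_compat_l; nra. }
    assert (Cmod (g k x) <= M - d1) by lra. nra.
Qed.

(** Dividing [g x * y] by [M] gives a polynomial of norm [1] whose numerical radius is at most
    [1 - d / M]. *)
Lemma numindex_lt_1 k : ~ poly_numindex_is N (S (S k)) 1.
Proof.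
  intros [Hlow _].
  destruct (g_sup k) as [M [HM Hlub]].
  destruct (numrad_gap k M HM Hlub) as [d [Hd0 Hgap]].
  assert (HiM : 0 < / M) by (apply Rinv_0_lt_compat; lra).
  assert (HMM : / M * M = 1) by (apply Rinv_l; lra).
  set (y' := vscale (RtoC (/ M)) y).
  set (P := fun x : V n => vscale (g k x) y').
  assert (Hy' : N y' = / M).
  { unfold y'. rewrite (norm_scale N HN), flipped_norm, Cmod_RtoC, Rabs_pos_eq; lra. }
  assert (HP : khom_poly (S (S k)) P) by (apply khomC_vec, gpol_khom).
  assert (HP1 : polynorm_is N P 1).
  { split.
    - intros s [x [Hx ->]]. unfold P. rewrite (norm_scale N HN), Hy', <- HMM, Rmult_comm.
      apply Rmult_le_compat_l; [lra|]. apply Hlub. exists x; auto.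
    - intros b Hb. assert (HMb : M <= M * b).
      { apply Hlub. intros s [x [Hx ->]].
        assert (Hbx : Cmod (g k x) * / M <= b).
        { apply Hb. exists x. split; [assumption|].
          unfold P. rewrite (norm_scale N HN), Hy'. reflexivity. }
        apply Rmult_le_compat_l with (r := M) in Hbx; [|lra].
        replace (M * (Cmod (g k x) * / M)) with (Cmod (g k x) * (/ M * M)) in Hbx by ring.
        rewrite HMM in Hbx. lra. }
      nra. }
  set (E := fun s => exists (x : V n) (f : V n -> C),
             N x = 1 /\ Clinear f /\ dualnorm_is N f 1 /\ f x = C1 /\
             s = Cmod (f (P x))).
  assert (Hub : is_upper_bound E (1 - d * / M)).
  { intros s (x & f & Hx & Hf & Hd & Hfx & ->).
    unfold P, y'. rewrite !(proj2 Hf), !Cmod_mul, Cmod_RtoC, Rabs_pos_eq by lra.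
    pose proof (Hgap x f Hx Hf Hd Hfx).
    replace (1 - d * / M) with (/ M * (M - d)) by lra.
    replace (Cmod (g k x) * (/ M * Cmod (f y)))
      with (/ M * (Cmod (g k x) * Cmod (f y))) by ring.
    apply Rmult_le_compat_l; lra. }
  (* The infimum ranges over existing numerical radii, so a supremum of [E] must be produced; [e_p]
     with its coordinate functional shows that [E] is nonempty. *)
  destruct (completeness E) as [v Hv].
  - exists (1 - d * / M); exact Hub.
  - destruct (coord_dual N HN HA p) as [Hl Hdu].
    eexists; exists (ecan p), (fun x => x p). repeat split; try apply Hdu.
    + apply (norm_ecan N HA).
    + unfold ecan; vcase; congruence.
  - assert (1 <= v) by (apply Hlow; exists P; auto).
    assert (v <= 1 - d * / M) by (apply Hv; exact Hub).
    nra.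
Qed.

End NotSupNorm.

(** * Locating the interval of coordinates *)

Definition ind {n} (a b : nat) : V n :=
  fun i => if le_dec a (proj1_sig i) then if lt_dec (proj1_sig i) b then C1 else C0 else C0.

Lemma nat_last_before_failure (Q : nat -> Prop) (m : nat) :
  Q O -> ~ Q m -> exists a, (a < m)%nat /\ Q a /\ ~ Q (S a).
Proof.
  intros H0. induction m as [|m IH]; intros Hm; [contradiction|].
  destruct (classic (Q m)) as [H|H].
  - exists m. auto.
  - destruct (IH H) as [a [Ha Hq]]. exists a; split; [lia|exact Hq].
Qed.

Lemma numindex_1_norm_ones {n} (N : V n -> R) k :
  is_norm N -> absolute_norm N -> poly_numindex_is N (S (S k)) 1 ->
  N (fun _ => C1) <= 1.
Proof.
  intros HN HA Hidx. destruct (Rle_dec (N (fun _ => C1)) 1) as [H|H]; [exact H|].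
  exfalso.
  assert (Hmono : forall a b c d, (c <= a)%nat -> (b <= d)%nat -> N (ind a b) <= N (ind c d)).
  { intros a b c d Hac Hbd. apply (norm_mono N HN HA). intros i. unfold ind.
    repeat destruct le_dec; repeat destruct lt_dec; try lia;
      rewrite ?Cmod_C0, ?Cmod_C1; lra. }
  (* This fixes the right end [b]: the norm of [ind 0 b] is at most [1], that of [ind 0 (S b)]
     exceeds [1]. *)
  destruct (nat_last_before_failure (fun b => N (ind 0 b) <= 1) n) as [b [Hb [Hb1 Hb2]]].
  { replace (ind 0 0) with (vscale C0 (ind 0 0) : V n).
    - rewrite (norm_scale N HN), Cmod_C0. lra.
    - extensionality i. unfold vscale, ind. repeat destruct le_dec; repeat destruct lt_dec; try lia; ring. }
  { replace (ind 0 n) with (fun _ : fin n => C1); [exact H|].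
    extensionality i. unfold ind. destruct i as [i Hi]; simpl.
    repeat destruct le_dec; repeat destruct lt_dec; try lia; reflexivity. }
  (* The left end now moves right until dropping [a] brings the norm down to at most [1]. At [a = b]
     only [e_b] remains, of norm [1]; hence [a < b] and the ends differ. *)
  destruct (nat_last_before_failure (fun a => ~ N (ind a (S b)) <= 1) b)
    as [a [Ha [Ha1 Ha2]]].
  { exact Hb2. }
  { intros Hc. apply Hc.
    replace (ind b (S b)) with (ecan (exist _ b Hb) : V n).
    - right; apply (norm_ecan N HA).
    - extensionality i. unfold ecan, ind; simpl.
      destruct Nat.eq_dec; repeat destruct le_dec; repeat destruct lt_dec; try lia; reflexivity. }
  apply NNPP in Ha2.
  assert (Han : (a < n)%nat) by lia.
  set (p := exist _ a Han : fin n). set (q := exist _ b Hb : fin n).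
  assert (Ep : vadd (ind (S a) b) (ecan p) = ind a b).
  { extensionality i. unfold vadd, ecan, ind, p; simpl.
    destruct Nat.eq_dec; repeat destruct le_dec; repeat destruct lt_dec; try lia; ring. }
  assert (Eq : vadd (ind (S a) b) (ecan q) = ind (S a) (S b)).
  { extensionality i. unfold vadd, ecan, ind, q; simpl.
    destruct Nat.eq_dec; repeat destruct le_dec; repeat destruct lt_dec; try lia; ring. }
  assert (Epq : vadd (ind (S a) b) (vadd (ecan p) (ecan q)) = ind a (S b)).
  { extensionality i. unfold vadd, ecan, ind, p, q; simpl.
    repeat destruct Nat.eq_dec; repeat destruct le_dec; repeat destruct lt_dec; try lia; ring. }
  apply (numindex_lt_1 N HN HA p q (ind (S a) b)) with k; try exact Hidx.
  - intros E. apply (f_equal (@proj1_sig _ _)) in E. simpl in E. lia.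
  - unfold ind, p; simpl. destruct le_dec; [lia|reflexivity].
  - unfold ind, q; simpl. destruct le_dec; [|reflexivity]. destruct lt_dec; [lia|reflexivity].
  - rewrite Ep. eapply Rle_trans; [|exact Hb1]. apply Hmono; lia.
  - rewrite Eq. exact Ha2.
  - rewrite Epq. lra.
Qed.

(** The identity works: if [b] bounds the moduli, monotonicity gives [N x <= b N (1, ..., 1) <= b].
    That [b >= 0] follows from coordinate [0], which exists as [1 <= n]. *)
Lemma isometric_of_norm_ones {n} (N : V n -> R) :
  (1 <= n)%nat -> is_norm N -> absolute_norm N -> N (fun _ => C1) <= 1 ->
  isometric_to_linf N.
Proof.
  intros Hn HN HA H1. exists (fun x => x). split; [|split].
  - split; reflexivity.
  - intros y; exists y; reflexivity.
  - intros x. split.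
    + intros t [i ->]. apply coord_le_norm; assumption.
    + intros b Hb.
      assert (Hb0 : 0 <= b).
      { eapply Rle_trans; [apply Cmod_ge0|].
        apply Hb. exists (exist _ O Hn). reflexivity. }
      apply Rle_trans with (N (vscale (RtoC b) (fun _ => C1))).
      * apply norm_mono; try assumption. intros i. unfold vscale.
        rewrite Cmod_mul, Cmod_C1, Cmod_RtoC, Rabs_pos_eq, Rmult_1_r by assumption.
        apply Hb. exists i; reflexivity.
      * rewrite (norm_scale N HN), Cmod_RtoC, Rabs_pos_eq by assumption. nra.
Qed.

(** * Maximum modulus on the polydisc *)

(** The shape [h f(h) + g(h)] is what linearity in one argument yields at [h e + x]. *)
Inductive poly1 : (C -> C) -> Prop :=
| poly1_const c : poly1 (fun _ => c)
| poly1_mulX f g : poly1 f -> poly1 g -> poly1 (fun h => Cadd (Cmul h (f h)) (g h)).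

Lemma khomC_line {n} k (A : (fin k -> V n) -> C) (e x : V n) :
  mlinC A -> poly1 (fun h => A (fun _ => vadd (vscale h e) x)).
Proof.
  intros HA.
  (* Induction on the number [l] of arguments replaced by [h e + x]; argument [l] is split into the
     cases [e] and [x]. *)
  assert (H : forall l, (l <= k)%nat -> forall ys : fin k -> V n,
    poly1 (fun h => A (fun m => if lt_dec (proj1_sig m) l
                                then vadd (vscale h e) x else ys m))).
  { induction l as [|l IH]; intros Hl ys.
    - replace (fun h => A _) with (fun _ : C => A ys); [constructor|].
      extensionality h. f_equal.
    - set (j := exist (fun i => (i < k)%nat) l Hl : fin k).
      assert (E : forall (h : C) (t : V n),
        (fun m => if lt_dec (proj1_sig m) l then vadd (vscale h e) x else upd ys j t m)
        = upd (fun m => if lt_dec (proj1_sig m) l then vadd (vscale h e) x else ys m) j t).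
      { intros h t. extensionality m. unfold upd, j; simpl.
        destruct lt_dec, Nat.eq_dec; try lia; reflexivity. }
      pose proof (poly1_mulX _ _ (IH ltac:(lia) (upd ys j e)) (IH ltac:(lia) (upd ys j x))) as H.
      refine (eq_ind _ poly1 H _ _). extensionality h. cbv beta.
      rewrite !E, <- HA. f_equal. extensionality m. unfold upd, j; simpl.
      destruct Nat.eq_dec, (lt_dec (proj1_sig m) l), (lt_dec (proj1_sig m) (S l));
        try lia; reflexivity. }
  specialize (H k (Nat.le_refl k) (fun _ => x)).
  refine (eq_ind _ poly1 H _ _). extensionality h. f_equal.
  extensionality m. destruct lt_dec; [reflexivity|]. destruct m; simpl in *; lia.
Qed.

(** Taylor expansion with cubic remainder, uniform over the unit disc: [c1] and [c2] depend on [z]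
    alone, while [c3] may depend on [h]. *)
Definition taylor2 (f : C -> C) (K : R) : Prop :=
  forall z, Cmod z <= 1 -> Cmod (f z) <= K /\
  exists c1 c2, Cmod c1 <= K /\ Cmod c2 <= K /\
  forall h, Cmod h <= 1 -> exists c3, Cmod c3 <= K /\
    f (Cadd z h) = Cadd (f z) (Cadd (Cmul c1 h)
      (Cadd (Cmul c2 (Cmul h h)) (Cmul c3 (Cmul h (Cmul h h))))).

Lemma Cmod_mul_le z w K : Cmod z <= 1 -> Cmod w <= K -> Cmod (Cmul z w) <= K.
Proof.
  intros Hz Hw. rewrite Cmod_mul.
  pose proof (Cmod_ge0 z); pose proof (Cmod_ge0 w). nra.
Qed.

Lemma Cmod_add_le z w K L : Cmod z <= K -> Cmod w <= L -> Cmod (Cadd z w) <= K + L.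
Proof. intros. pose proof (Cmod_add z w). lra. Qed.

Lemma poly1_taylor2 f : poly1 f -> exists K, 0 <= K /\ taylor2 f K.
Proof.
  induction 1 as [c|f g _ [K [HK Hf]] _ [L [HL Hg]]].
  - exists (Cmod c). split; [apply Cmod_ge0|]. intros z _. split; [lra|].
    pose proof (Cmod_ge0 c). exists C0, C0. rewrite !Cmod_C0. repeat split; try lra.
    intros h _. exists C0. rewrite Cmod_C0. split; [lra|]. ring.
  (* Each coefficient of [(z + h) f(z + h)] is a sum of at most three terms bounded by [K]; [g] adds
     one bounded by [L]. *)
  - exists (3 * K + L). split; [lra|].
    intros z Hz. destruct (Hf z Hz) as [Bf (a1 & a2 & Ha1 & Ha2 & Ef)].
    destruct (Hg z Hz) as [Bg (b1 & b2 & Hb1 & Hb2 & Eg)].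
    split.
    { apply Rle_trans with (K + L); [|lra]. apply Cmod_add_le; [apply Cmod_mul_le|]; assumption. }
    exists (Cadd (Cadd (Cmul z a1) (f z)) b1), (Cadd (Cadd (Cmul z a2) a1) b2).
    split; [|split].
    + apply Rle_trans with ((K + K) + L); [|lra].
      repeat apply Cmod_add_le; try apply Cmod_mul_le; assumption.
    + apply Rle_trans with ((K + K) + L); [|lra].
      repeat apply Cmod_add_le; try apply Cmod_mul_le; assumption.
    + intros h Hh. destruct (Ef h Hh) as (a3 & Ha3 & Ef3), (Eg h Hh) as (b3 & Hb3 & Eg3).
      exists (Cadd (Cadd (Cadd (Cmul z a3) (Cmul h a3)) a2) b3). split.
      * apply Rle_trans with (((K + K) + K) + L); [|lra].
        repeat apply Cmod_add_le; try apply Cmod_mul_le; assumption.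
      * rewrite Ef3, Eg3. ring.
Qed.

(* The mean of [f] over the four points [z + i^l t] agrees with [f z] up to
   [O(t^3)], while the mean of the squared modulus gains exactly [t^2]; hence
   [|f|^2 + eps |.|^2] increases at one of the four points. *)
Lemma four_point_ascent f K eps t z :
  0 <= K -> taylor2 f K -> 0 < eps -> 0 < t <= 1 -> 4 * K ^ 2 * t <= eps ->
  Cmod z <= 1 ->
  exists h, Cmod h = t /\
    Cmod (f z) ^ 2 + eps * Cmod z ^ 2 + eps * t ^ 2 / 2
    <= Cmod (f (Cadd z h)) ^ 2 + eps * Cmod (Cadd z h) ^ 2.
Proof.
  intros HK Hf Heps Ht Hsmall Hz.
  destruct (Hf z Hz) as [Bf (c1 & c2 & _ & _ & Hh)].
  set (h1 := mkC t 0). set (h2 := mkC (- t) 0). set (h3 := mkC 0 t). set (h4 := mkC 0 (- t)).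
  assert (T1 : Cmod h1 = t).
  { apply Rsqr_inj; [apply Cmod_ge0|lra|]. rewrite !Rsqr_pow2, Cmod_sqr. simpl; ring. }
  assert (T2 : Cmod h2 = t).
  { apply Rsqr_inj; [apply Cmod_ge0|lra|]. rewrite !Rsqr_pow2, Cmod_sqr. simpl; ring. }
  assert (T3 : Cmod h3 = t).
  { apply Rsqr_inj; [apply Cmod_ge0|lra|]. rewrite !Rsqr_pow2, Cmod_sqr. simpl; ring. }
  assert (T4 : Cmod h4 = t).
  { apply Rsqr_inj; [apply Cmod_ge0|lra|]. rewrite !Rsqr_pow2, Cmod_sqr. simpl; ring. }
  destruct (Hh h1 ltac:(lra)) as (r1 & B1 & E1).
  destruct (Hh h2 ltac:(lra)) as (r2 & B2 & E2).
  destruct (Hh h3 ltac:(lra)) as (r3 & B3 & E3).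
  destruct (Hh h4 ltac:(lra)) as (r4 & B4 & E4).
  (* These are the cubes of [i] and [-i]. The linear and quadratic terms cancel over the four
     points, leaving the cubic remainders in [E]. *)
  set (i3 := mkC 0 (-1)). set (i1 := mkC 0 1).
  set (E := Cmul (RtoC (t ^ 3))
     (Cadd (Cadd r1 (Copp r2)) (Cadd (Cmul i3 r3) (Cmul i1 r4)))).
  assert (Hsum : Cadd (Cadd (f (Cadd z h1)) (f (Cadd z h2)))
                      (Cadd (f (Cadd z h3)) (f (Cadd z h4)))
                 = Cadd (Cmul (RtoC 4) (f z)) E).
  { rewrite E1, E2, E3, E4. unfold E, h1, h2, h3, h4, i1, i3. Cring. }
  assert (HE : Cmod E <= 4 * K * t ^ 3).
  { unfold E. rewrite Cmod_mul, Cmod_RtoC.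
    assert (0 <= t ^ 3) by (apply pow_le; lra).
    rewrite Rabs_pos_eq by assumption. rewrite Rmult_comm.
    apply Rmult_le_compat_r; [assumption|].
    apply Rle_trans with ((K + K) + (K + K)); [|lra].
    repeat apply Cmod_add_le; try assumption; try (rewrite Cmod_opp; assumption);
      apply Cmod_mul_le; try assumption; unfold Cmod; simpl;
      match goal with |- sqrt ?a <= 1 => replace a with 1 by ring end;
      rewrite sqrt_1; lra. }
  pose proof (Cmod_ge0 (f z)) as H0. pose proof (Cmod_ge0 E) as HE0.
  assert (Hcs : - (Cmod (f z) * Cmod E) <= Cre (f z) * Cre E + Cim (f z) * Cim E).
  { pose proof (Cauchy_Schwarz_C (f z) E) as Hc.
    pose proof (Rle_abs (- (Cre (f z) * Cre E + Cim (f z) * Cim E))) as Ha.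
    rewrite Rabs_Ropp in Ha. lra. }
  assert (HfE : Cmod (f z) * Cmod E <= eps * t ^ 2).
  { apply Rle_trans with (K * (4 * K * t ^ 3)); [apply Rmult_le_compat; lra|].
    replace (K * (4 * K * t ^ 3)) with (4 * K ^ 2 * t * t ^ 2) by ring.
    apply Rmult_le_compat_r; [apply pow_le; lra|assumption]. }
  assert (Hmean : 4 * Cmod (f z) ^ 2 - 2 * (eps * t ^ 2) <=
     Cmod (f (Cadd z h1)) ^ 2 + Cmod (f (Cadd z h2)) ^ 2
     + Cmod (f (Cadd z h3)) ^ 2 + Cmod (f (Cadd z h4)) ^ 2).
  { assert (Hvar : forall u, Cmod u ^ 2 >= 2 * (Cre (f z) * Cre u + Cim (f z) * Cim u) - Cmod (f z) ^ 2).
    { intros u. rewrite !Cmod_sqr.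
      pose proof (pow2_ge_0 (Cre u - Cre (f z))); pose proof (pow2_ge_0 (Cim u - Cim (f z))). nra. }
    pose proof (Hvar (f (Cadd z h1))) as V1. pose proof (Hvar (f (Cadd z h2))) as V2.
    pose proof (Hvar (f (Cadd z h3))) as V3. pose proof (Hvar (f (Cadd z h4))) as V4.
    assert (R1 : Cre (f (Cadd z h1)) + Cre (f (Cadd z h2)) + (Cre (f (Cadd z h3)) + Cre (f (Cadd z h4)))
                 = 4 * Cre (f z) + Cre E).
    { transitivity (Cre (Cadd (Cmul (RtoC 4) (f z)) E)); [rewrite <- Hsum; reflexivity|].
      clearbody E; simpl; ring. }
    assert (R2 : Cim (f (Cadd z h1)) + Cim (f (Cadd z h2)) + (Cim (f (Cadd z h3)) + Cim (f (Cadd z h4)))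
                 = 4 * Cim (f z) + Cim E).
    { transitivity (Cim (Cadd (Cmul (RtoC 4) (f z)) E)); [rewrite <- Hsum; reflexivity|].
      clearbody E; simpl; ring. }
    apply (f_equal (Rmult (Cre (f z)))) in R1. apply (f_equal (Rmult (Cim (f z)))) in R2.
    pose proof (Cmod_sqr (f z)) as Q. nra. }
  assert (Hquad : Cmod (Cadd z h1) ^ 2 + Cmod (Cadd z h2) ^ 2
     + Cmod (Cadd z h3) ^ 2 + Cmod (Cadd z h4) ^ 2 = 4 * Cmod z ^ 2 + 4 * t ^ 2).
  { rewrite !Cmod_sqr. unfold h1, h2, h3, h4; simpl. ring. }
  (* The total gain is at least [4 eps t^2 - 2 eps t^2] by [Hquad] and [Hmean], so four gains below
     [eps t^2 / 2] are impossible. *)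
  apply NNPP. intros Hno.
  assert (Hlt : forall h, Cmod h = t ->
    Cmod (f (Cadd z h)) ^ 2 + eps * Cmod (Cadd z h) ^ 2
    < Cmod (f z) ^ 2 + eps * Cmod z ^ 2 + eps * t ^ 2 / 2).
  { intros h Hht. apply Rnot_le_lt. intros Hc. apply Hno. exists h; auto. }
  pose proof (Hlt h1 T1); pose proof (Hlt h2 T2).
  pose proof (Hlt h3 T3); pose proof (Hlt h4 T4).
  apply (f_equal (Rmult eps)) in Hquad. nra.
Qed.

(** Take for [w] the phase of [z], at distance [1 - |z| <= t]; each of the three Taylor increments
    is at most [K t]. *)
Lemma taylor2_to_circle f K t z :
  0 <= K -> taylor2 f K -> 0 < t <= 1 / 2 -> 1 - t < Cmod z <= 1 ->
  exists w, Cmod w = 1 /\ Cmod (f z) - 3 * K * t <= Cmod (f w).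
Proof.
  intros HK Hf Ht Hz.
  destruct (C_polar z) as [w [Hw Ez]]. exists w. split; [exact Hw|].
  set (h := Cmul (RtoC (1 - Cmod z)) w).
  assert (Eh : Cadd z h = w).
  { unfold h. rewrite Ez at 1. Cring. }
  assert (Hh : Cmod h <= t).
  { unfold h. rewrite Cmod_mul, Hw, Cmod_RtoC, Rabs_pos_eq; lra. }
  clearbody h.
  destruct (Hf z ltac:(lra)) as [_ (c1 & c2 & H1 & H2 & Hc)].
  destruct (Hc h ltac:(lra)) as (c3 & H3 & E).
  rewrite Eh in E. rewrite E.
  set (d := Cadd (Cmul c1 h) _).
  assert (Hd : Cmod d <= 3 * K * t).
  { replace d with (Cmul h (Cadd c1 (Cadd (Cmul h c2) (Cmul h (Cmul h c3))))) by (unfold d; ring).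
    rewrite Cmod_mul, Rmult_comm.
    pose proof (Cmod_ge0 h).
    apply Rmult_le_compat; [apply Cmod_ge0|assumption| |assumption].
    apply Rle_trans with (K + (K + K)); [|lra].
    repeat apply Cmod_add_le; repeat apply Cmod_mul_le; lra. }
  pose proof (Cmod_sub (f z) (Copp d)) as Hs. rewrite Cmod_opp in Hs.
  replace (Csub (f z) (Copp d)) with (Cadd (f z) d) in Hs by ring. lra.
Qed.

Lemma poly1_max_modulus f z e :
  poly1 f -> Cmod z <= 1 -> 0 < e ->
  exists w, Cmod w = 1 /\ Cmod (f z) ^ 2 - e <= Cmod (f w) ^ 2.
Proof.
  intros Hp Hz He. destruct (poly1_taylor2 f Hp) as [K [HK Hf]].
  set (eps := e / 2).
  (* The three summands give [t <= 1/2], the smallness needed by [four_point_ascent], and a loss of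
     at most [e / 2] in passing to the circle. *)
  set (B := 2 + 4 * K ^ 2 / eps + 12 * K ^ 2 / e).
  assert (Heps : 0 < eps) by (unfold eps; lra).
  assert (HK2 : 0 <= K ^ 2) by (apply pow_le; assumption).
  assert (Hq1 : 0 <= 4 * K ^ 2 / eps).
  { apply Rmult_le_pos; [lra|left; apply Rinv_0_lt_compat; lra]. }
  assert (Hq2 : 0 <= 12 * K ^ 2 / e).
  { apply Rmult_le_pos; [lra|left; apply Rinv_0_lt_compat; lra]. }
  set (t := / B).
  assert (Ht0 : 0 < t) by (apply Rinv_0_lt_compat; unfold B; lra).
  assert (HtB : B * t = 1) by (apply Rinv_r; unfold B; lra).
  assert (Ht1 : t <= 1 / 2) by (unfold B in HtB; nra).
  assert (Ht2 : 4 * K ^ 2 * t <= eps).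
  { replace (4 * K ^ 2 * t) with (eps * (4 * K ^ 2 / eps * t)) by (field; lra).
    assert (4 * K ^ 2 / eps * t <= 1) by (unfold B in HtB; nra). nra. }
  assert (Ht3 : 12 * K ^ 2 * t <= e).
  { replace (12 * K ^ 2 * t) with (e * (12 * K ^ 2 / e * t)) by (field; lra).
    assert (12 * K ^ 2 / e * t <= 1) by (unfold B in HtB; nra). nra. }
  set (phi := fun u => Cmod (f u) ^ 2 + eps * Cmod u ^ 2).
  (* A point of the smaller disc with [phi] within [eps t^2 / 2] of the supremum has a neighbour
     exceeding it, which must lie in the annulus. *)
  assert (Hann : exists z', 1 - t < Cmod z' <= 1 /\ phi z <= phi z').
  { destruct (Rlt_dec (1 - t) (Cmod z)) as [Hzt|Hzt]; [exists z; split; lra|].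
    destruct (completeness (fun s => exists u, Cmod u <= 1 - t /\ s = phi u)) as [S [HS1 HS2]].
    - exists (K ^ 2 + eps * 1). intros s [u [Hu ->]]. unfold phi.
      pose proof (Cmod_ge0 u). pose proof (Cmod_ge0 (f u)).
      destruct (Hf u ltac:(lra)) as [Hb _].
      apply Rplus_le_compat; [apply pow_incr; lra|].
      apply Rmult_le_compat_l; [lra|]. nra.
    - exists (phi z), z. split; [lra|reflexivity].
    - assert (Hgain : 0 < eps * t ^ 2 / 2).
      { assert (0 < t ^ 2) by (apply pow_lt; lra). nra. }
      assert (Hu : exists u, Cmod u <= 1 - t /\ S - eps * t ^ 2 / 2 < phi u).
      { apply NNPP. intros Hno.
        assert (S <= S - eps * t ^ 2 / 2); [|lra].
        apply HS2. intros s [u [Hu ->]]. apply Rnot_lt_le. intros Hlt. apply Hno.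
        exists u; auto. }
      destruct Hu as [u [Hu1 Hu2]].
      destruct (four_point_ascent f K eps t u) as [h [Hh Hasc]]; try assumption; try lra.
      exists (Cadd u h). fold (phi u) (phi (Cadd u h)) in Hasc.
      pose proof (Cmod_add u h) as Htri.
      assert (HzS : phi z <= S) by (apply HS1; exists z; split; [lra|reflexivity]).
      split; [|lra]. split; [|lra].
      apply Rnot_le_lt. intros Hc.
      assert (phi (Cadd u h) <= S) by (apply HS1; exists (Cadd u h); auto). lra. }
  destruct Hann as [z' [Hz' Hphi]].
  destruct (taylor2_to_circle f K t z') as [w [Hw Hfw]]; try assumption; try lra.
  exists w. split; [exact Hw|].
  destruct (Hf z' ltac:(lra)) as [Hb _].
  pose proof (Cmod_ge0 (f z')); pose proof (Cmod_ge0 (f w)).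
  unfold phi in Hphi.
  assert (Hz2 : 0 <= Cmod z ^ 2) by (apply pow_le, Cmod_ge0).
  assert (Hz2' : Cmod z' ^ 2 <= 1) by (pose proof (Cmod_ge0 z'); nra).
  assert (Hstep : Cmod (f z) ^ 2 - eps <= Cmod (f z') ^ 2) by nra.
  assert (Hlast : Cmod (f z') ^ 2 - 6 * K ^ 2 * t <= Cmod (f w) ^ 2).
  { assert (HKt : 0 <= 3 * K * t) by (apply Rmult_le_pos; lra).
    destruct (Rle_dec (Cmod (f z')) (3 * K * t)) as [Hc|Hc].
    - assert (Cmod (f z') ^ 2 <= K * (3 * K * t)) by nra. nra.
    - assert ((Cmod (f z') - 3 * K * t) ^ 2 <= Cmod (f w) ^ 2) by (apply pow_incr; lra).
      assert (Cmod (f z') * (3 * K * t) <= K * (3 * K * t)) by (apply Rmult_le_compat_r; lra).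
      nra. }
  unfold eps in Hstep. lra.
Qed.

(** Coordinates move to the circle one at a time; each stage spends half of its error and leaves the
    other half to the earlier stages. *)
Lemma khomC_max_modulus {n} k (G : V n -> C) z e :
  khomC k G -> (forall i, Cmod (z i) <= 1) -> 0 < e ->
  exists w, (forall i, Cmod (w i) = 1) /\ Cmod (G z) ^ 2 - e <= Cmod (G w) ^ 2.
Proof.
  intros [A [HA HG]] Hz.
  assert (H : forall d, (d <= n)%nat -> forall e, 0 < e ->
    exists w, (forall i, Cmod (w i) <= 1) /\
      (forall i, (proj1_sig i < d)%nat -> Cmod (w i) = 1) /\
      Cmod (G z) ^ 2 - e <= Cmod (G w) ^ 2).
  { induction d as [|d IH]; intros Hd e' He'.
    - exists z. split; [assumption|split; [intros; lia|lra]].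
    - destruct (IH ltac:(lia) (e' / 2) ltac:(lra)) as [w [Hw1 [Hw2 Hw3]]].
      set (j := exist (fun i => (i < n)%nat) d Hd : fin n).
      pose proof (khomC_line k A (ecan j) (vset w j C0) HA) as Hp.
      destruct (poly1_max_modulus _ (w j) (e' / 2) Hp (Hw1 j) ltac:(lra)) as [c [Hc Hm]].
      cbv beta in Hm. rewrite <- !vset_split, vset_self, <- !HG in Hm.
      exists (vset w j c). split; [|split; [|lra]].
      + intros i. unfold vset; vcase; [lra|apply Hw1].
      + intros i Hi. unfold vset; vcase; [lra|]. apply Hw2. simpl in *; lia. }
  intros He. destruct (H n (Nat.le_refl n) e He) as [w [_ [Hw2 Hw3]]].
  exists w. split; [|exact Hw3]. intros i. apply Hw2. destruct i; assumption.
Qed.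

(** * Spaces isometric to the sup norm *)

Lemma linf_index_ge_1 {n} (N : V n -> R) k P s :
  is_norm N -> isometric_to_linf N ->
  khom_poly k P -> polynorm_is N P 1 -> numrad_is N P s -> 1 <= s.
Proof.
  intros HN (T & [Tadd Tsc] & Tsurj & Tiso) [A [HA HP]] [_ Hn1] [Hs _].
  (* [S] is a right inverse of [T]; injectivity of [T] makes it linear, so [P] transfers to the
     polydisc. *)
  set (S := fun z => proj1_sig (constructive_indefinite_description _ (Tsurj z))).
  assert (TS : forall z, T (S z) = z).
  { intros z. unfold S. apply proj2_sig. }
  assert (Tle : forall x i, Cmod (T x i) <= N x).
  { intros x i. apply (Tiso x). exists i; reflexivity. }
  assert (TN : forall x r, (forall i, Cmod (T x i) <= r) -> N x <= r).
  { intros x r Hr. apply (Tiso x). intros t [i ->]. apply Hr. }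
  assert (Tinj : forall x y, T x = T y -> x = y).
  { intros x y E. set (u := vadd x (vscale (Copp C1) y)).
    assert (Hu : N u = 0).
    { apply Rle_antisym; [|apply norm_ge0; assumption].
      apply TN. intros i. unfold u. rewrite Tadd, Tsc, E. unfold vadd, vscale.
      replace (Cadd (T y i) (Cmul (Copp C1) (T y i))) with C0 by ring.
      rewrite Cmod_C0; lra. }
    extensionality i. pose proof (proj1 HN u Hu i) as H. unfold u, vadd, vscale in H.
    replace (x i) with (Cadd (Cadd (x i) (Cmul (Copp C1) (y i))) (y i)) by ring.
    rewrite H. ring. }
  clearbody S.
  assert (HG : forall i, khomC k (fun z => T (P (S z)) i)).
  { intros i. exists (fun zs => T (A (fun m => S (zs m))) i). split.
    - intros zs j a u v.
      assert (E : forall t, (fun m => S (upd zs j t m)) = upd (fun m => S (zs m)) j (S t)).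
      { intros t. extensionality m. unfold upd. vcase; reflexivity. }
      rewrite !E. replace (S (vadd (vscale a u) v)) with (vadd (vscale a (S u)) (S v)).
      + rewrite HA, Tadd, Tsc. reflexivity.
      + apply Tinj. rewrite Tadd, Tsc, !TS. reflexivity.
    - intros z. rewrite HP. reflexivity. }
  apply Hn1. intros r [x [Hx ->]]. apply TN. intros i.
  assert (Hmax : forall e, 0 < e -> 0 <= s /\ Cmod (T (P x) i) ^ 2 - e <= s ^ 2).
  { intros e He.
    destruct (khomC_max_modulus k _ (T x) e (HG i)) as [w [Hw Hm]];
      [intros j; eapply Rle_trans; [apply Tle|exact Hx]|exact He|].
    replace (S (T x)) with x in Hm by (apply Tinj; rewrite TS; reflexivity).
    (* Since [|w_i| = 1], this functional takes the value [1] at [S w] and has the modulus of the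
       [i]-th coordinate of [T]. *)
    set (f := fun v : V n => Cmul (Cconj (w i)) (T v i)).
    assert (Hmod : forall v, Cmod (f v) = Cmod (T v i)).
    { intros v. unfold f. rewrite Cmod_mul, Cmod_conj, Hw. ring. }
    assert (HSw : N (S w) = 1).
    { apply Rle_antisym.
      - apply TN. intros j. rewrite TS, Hw. lra.
      - pose proof (Tle (S w) i) as Hi. rewrite TS, Hw in Hi. exact Hi. }
    assert (Hle : Cmod (T (P (S w)) i) <= s).
    { apply Hs. exists (S w), f. split; [exact HSw|]. split; [|split; [|split]].
      - split; intros; unfold f; [rewrite Tadd|rewrite Tsc]; unfold vadd, vscale; ring.
      - split.
        + intros t [v [Hv ->]]. rewrite Hmod. eapply Rle_trans; [apply Tle|exact Hv].
        + intros b Hb. apply Hb. exists (S w). rewrite Hmod, TS, Hw. split; lra.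
      - unfold f. rewrite TS, Cmul_conj, Hw. Cring.
      - rewrite Hmod. reflexivity. }
    pose proof (Cmod_ge0 (T (P (S w)) i)).
    split; [lra|]. eapply Rle_trans; [exact Hm|]. apply pow_incr; lra. }
  apply Rle_of_sqr; [apply (Hmax 1); lra|].
  apply le_epsilon. intros e He. pose proof (proj2 (Hmax e He)). lra.
Qed.

(** The polynomial [x_j^k e_j] shows that the index never exceeds [1]; [e_j] with its coordinate
    functional attains the value. *)
Lemma index_1_attained {n} (N : V n -> R) k (j : fin n) :
  is_norm N -> absolute_norm N ->
  exists P, khom_poly k P /\ polynorm_is N P 1 /\ numrad_is N P 1.
Proof.
  intros HN HA.
  exists (fun x => vscale (Cpow (x j) k) (ecan j)).
  assert (Hpow : forall x, N x <= 1 -> Cmod (x j) ^ k <= 1).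
  { intros x Hx. rewrite <- (pow1 k). apply pow_incr. split; [apply Cmod_ge0|].
    eapply Rle_trans; [apply (coord_le_norm N HN HA)|exact Hx]. }
  assert (Ej : @ecan n j j = C1) by (unfold ecan; vcase; congruence).
  destruct (coord_dual N HN HA j) as [Hl Hd].
  split; [|split].
  - apply khomC_vec, khomC_pow. exact Hl.
  - split.
    + intros s [x [Hx ->]].
      rewrite (norm_scale N HN), (norm_ecan N HA), Cmod_pow, Rmult_1_r. auto.
    + intros b Hb. apply Hb. exists (ecan j). rewrite (norm_ecan N HA). split; [lra|].
      rewrite (norm_scale N HN), (norm_ecan N HA), Ej, Cmod_pow, Cmod_C1, pow1. ring.
  - split.
    + intros s (x & f & Hx & Hf & Hdf & _ & ->).
      rewrite (proj2 Hf), Cmod_mul, Cmod_pow.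
      pose proof (dual_le N HN f (ecan j) Hf Hdf) as H.
      rewrite (norm_ecan N HA) in H.
      pose proof (Hpow x ltac:(lra)). pose proof (Cmod_ge0 (f (ecan j))).
      pose proof (pow_le _ k (Cmod_ge0 (x j))). nra.
    + intros b Hb. apply Hb. exists (ecan j), (fun x => x j).
      split; [apply (norm_ecan N HA)|]. split; [exact Hl|]. split; [exact Hd|].
      split; [exact Ej|].
      unfold vscale. rewrite Ej, Cmod_mul, Cmod_pow, Cmod_C1, pow1. ring.
Qed.

Theorem theorem4p6 (n : nat) (N : V n -> R) (k : nat) :
  (1 <= n)%nat -> (2 <= k)%nat ->
  is_norm N -> absolute_norm N ->
  (poly_numindex_is N k 1 <-> isometric_to_linf N).
Proof.
  intros Hn Hk HN HA. split; intros H.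
  - apply isometric_of_norm_ones; try assumption.
    destruct k as [|[|k]]; try lia.
    apply (numindex_1_norm_ones N k); assumption.
  - split.
    + intros s (P & HP & HP1 & Hs).
      apply (linf_index_ge_1 N k P s HN H HP HP1 Hs).
    + intros b Hb. apply Hb.
      apply (index_1_attained N k (exist _ O Hn) HN HA).
Qed.
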